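(* Let $\mathbf P=(P,\leq)$ be a partially ordered set with maximum $1$ and suppose that $a \in P$ is a $1$-compact element of $\mathbf P$, or just that $a$ is very-weakly-$1$-compact. Then $a$ is a non-generator if and only if $a \leq p$ for every maximal$_{<1}$ element $p$ of $\mathbf P$.
   Context: Let $\mathbf P=(P,\leq)$ be a poset with maximum $1$ (not assumed to be a semilattice). For $a,e \in P$, ''$a \vee e = 1$'' means that there is no $p \in P$ such that $p<1$, $a \leq p$ and $e \leq p$. For $X\subseteq P$, ''$\bigvee X=1$'' means that there is no $p\in P$ such that $p<1$ and $x\leq p$ for every $x\in X$. An element $a\in P$ is a non-generator if, for every $e \in P$, $a\vee e=1$ implies $e=1$. An element $p\in P$ is maximal$_{<1}$ if $p<1$ and there is no $q \in P$ such that $p<q<1$. An element $e\in P$ can be extended to a maximal$_{<1}$ element if there is a maximal$_{<1}$ element $p$ with $e \leq p$. A chain is a nonempty subset that is linearly ordered by the induced order; chains are denoted as families $(e_i)_{i\in I}$. An element $a$ is $1$-compact if, whenever $(e_i)_{i\in I}$ is a chain of elements of $P$ and $\bigvee_{i\in I}e_i=1$, then $a\leq e_i$ for some $i \in I$. An element $a$ is very-weakly-$1$-compact if, whenever $(e_i)_{i\in I}$ is a chain of elements of $P$ with $e_i<1$ for every $i\in I$, $\bigvee_{i\in I}e_i=1$, and no $e_i$ can be extended to a maximal$_{<1}$ element, then there are some $i\in I$ and some $r\in P$ such that $r<1$, $e_i\leq r$ and $a\leq r$. *)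

(* Defs.v *)
From HB Require Import structures.
From mathcomp Require Import all_boot all_order.
From mathcomp Require Import classical_sets.

Set Implicit Arguments.
Unset Strict Implicit.
Unset Printing Implicit Defensive.

Import Order.TTheory.
Local Open Scope classical_set_scope.
Local Open Scope order_scope.

Section PosetWithMaximum.
Context {d : Order.disp_t} {P : tPOrderType d}.
Implicit Types (a e p : P) (X C : set P).

(* [P] need not be a semilattice: "the join is 1" only says that no element
   strictly below [\top] is an upper bound. *)
Definition join_eq1 a e := ~ exists p, [/\ p < \top, a <= p & e <= p].

Definition bigjoin_eq1 X := ~ exists p, p < \top /\ forall x, X x -> x <= p.

Definition non_generator a := forall e, join_eq1 a e -> e = \top.

Definition maximal_lt1 p := p < \top /\ ~ exists q, p < q /\ q < \top.

Definition extends_to_maximal_lt1 e := exists p, maximal_lt1 p /\ e <= p.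

(* A chain [(e_i)_(i in I)] is represented by the set of its members. *)
Definition chain C := C !=set0 /\ total_on C (fun x y => x <= y).

Definition one_compact a :=
  forall C, chain C -> bigjoin_eq1 C -> exists e, C e /\ a <= e.

Definition very_weakly_one_compact a :=
  forall C, chain C ->
    (forall e, C e -> e < \top) ->
    bigjoin_eq1 C ->
    (forall e, C e -> ~ extends_to_maximal_lt1 e) ->
    exists e r, [/\ C e, r < \top, e <= r & a <= r].

End PosetWithMaximum.

(* Main.v *)
(** A maximal element [p] has join 1 with every element not below it. By Zorn's
    lemma, an [e < 1] that does not extend to a maximal element lies below a
    chain of elements [< 1] whose join is 1. No member of this chain extends to
    a maximal element either, so very-weak 1-compactness bounds [a] and some
    member of the chain, hence [a] and [e], by one element [< 1]. *)
Require Import Defs.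
From mathcomp Require Import all_boot all_order.
From mathcomp Require Import boolp classical_sets.
Import Order.TTheory.
Local Open Scope order_scope.

Lemma one_compact_very_weakly {d : Order.disp_t} {P : tPOrderType d} {a : P} :
  one_compact a -> very_weakly_one_compact a.
Proof.
move=> a_cpt C C_chain C_lt1 C_join _.
have [e [Ce le_ae]] := a_cpt C C_chain C_join.
(* The member [e] also serves as the common bound [r]. *)
by exists e, e; split; rewrite ?C_lt1.
Qed.

(** A common upper bound below [\top] would equal [p] by maximality, placing [a] below [p]. *)
Lemma maximal_lt1_join_eq1 {d : Order.disp_t} {P : tPOrderType d} {a p : P} :
  maximal_lt1 p -> ~ a <= p -> join_eq1 a p.
Proof.
move=> [_ p_max] nle_ap [q [lt_q1 le_aq le_pq]]; apply: p_max; exists q.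
split=> //; rewrite lt_neqAle le_pq andbT.
by apply/eqP=> eq_pq; apply: nle_ap; rewrite eq_pq.
Qed.

(** Otherwise every chain in [T], the elements from [e] up to but excluding [\top], is bounded in
    [T], and Zorn's lemma gives a maximal element above [e]. *)
Lemma not_extends_to_maximal_lt1_chain {d : Order.disp_t} {P : tPOrderType d}
    {e : P} :
  e < \top -> ~ extends_to_maximal_lt1 e ->
  exists C : set P, [/\ chain C, forall x, C x -> e <= x < \top & bigjoin_eq1 C].
Proof.
move=> lt_e1 e_next; apply: contrapT => no_chain; apply: e_next.
pose T := {x : P | e <= x < \top}.
have e_in : e <= e < \top by rewrite lexx.
have [||C C_tot|t t_max] :=
  @ZL_preorder T (exist _ e e_in) (fun x y => sval x <= sval y).
- by move=> x; exact: lexx.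
- by move=> x y z; exact: le_trans.
- have [[x Cx]|C_empty] := pselect (exists x, C x); last first.
    (* The empty set is no [chain] but still needs a bound in [T]; [e] serves. *)
    by exists (exist _ e e_in) => x Cx; case: C_empty; exists x.
  have [[p [lt_p1 C_le_p]]|C_join] :=
    pselect (exists p, p < \top /\ forall y, C y -> sval y <= p).
    have p_in : e <= p < \top.
      by rewrite lt_p1 andbT (le_trans _ (C_le_p x Cx))//; case/andP: (svalP x).
    by exists (exist _ p p_in).
  case: no_chain; exists (image C sval); split.
  + split; first by exists (sval x), x.
    by move=> _ _ [y Cy <-] [z Cz <-]; exact: C_tot.
  + by move=> _ [y _ <-]; exact: (svalP y).
  + move=> [p [lt_p1 p_ub]]; apply: C_join; exists p; split=> // y Cy.
    by apply: p_ub; exists y.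
(* Any [q < \top] above [t] is above [e], hence in [T], so [t] is maximal in [P] too. *)
- have /andP[le_et lt_t1] := svalP t.
  exists (sval t); split=> //; split=> // -[q [lt_tq lt_q1]].
  have q_in : e <= q < \top by rewrite (le_trans le_et (ltW lt_tq)).
  have le_qt := t_max (exist _ q q_in) (ltW lt_tq).
  by have := lt_le_trans lt_tq le_qt; rewrite ltxx.
Qed.

Theorem corollary2p5 (d : Order.disp_t) (P : tPOrderType d) (a : P)
    (ha : one_compact a \/ very_weakly_one_compact a) :
  non_generator a <-> (forall p : P, maximal_lt1 p -> a <= p).
Proof.
have {ha} a_cpt : very_weakly_one_compact a.
  by case: ha => // /one_compact_very_weakly.
split=> [a_ngen p p_max | a_le e ae_join].
  apply: contrapT => /(maximal_lt1_join_eq1 p_max) /a_ngen p_top.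
  by case: p_max; rewrite p_top ltxx.
apply: contrapT => /eqP; rewrite -ltx1 => lt_e1.
(* A maximal element above [e] would also be above [a] by [a_le], against [ae_join]. *)
have e_next : ~ extends_to_maximal_lt1 e.
  move=> [p [p_max le_ep]]; apply: ae_join; exists p; split=> //.
    by case: p_max.
  exact: a_le.
have [C [C_chain C_in C_join]] := not_extends_to_maximal_lt1_chain lt_e1 e_next.
have [x Cx|x Cx [p [p_max le_xp]]|x [r [Cx lt_r1 le_xr le_ar]]] :=
  a_cpt C C_chain _ C_join.
- by case/andP: (C_in x Cx).
- have /andP[le_ex _] := C_in x Cx.
  by apply: e_next; exists p; split=> //; exact: le_trans le_xp.
- have /andP[le_ex _] := C_in x Cx.
  by apply: ae_join; exists r; split=> //; exact: le_trans le_xr.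
Qed.
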